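(* Let $d \geq 2$ and $k \in \{1, \ldots, d-1\}$ be integers. Then $$\underline{sa}_d^s(d+k) \geq \frac{d^2 - k^2 + d + k}{2} = \Theta((d-k)d).$$
   Context: Let $X=\{x_1,\dots,x_n\}\subset\mathbb{R}^d$ be a finite set (with $x_i\neq x_j$ for $i\ne j$) whose affine hull is $\mathbb{R}^d$, and let $P=\operatorname{conv}X$. Two distinct points $x_i,x_j\in X$ are strictly antipodal (in $X$) if there are different parallel supporting hyperplanes $H',H''$ of $P$ with $X\cap H'=\{x_i\}$ and $X\cap H''=\{x_j\}$. $sa(X)$ is the number of (unordered) strictly antipodal pairs of $X$. $X$ is in strictly convex position if $X=\operatorname{vert}P$ (the vertex set of $P$). $\mathcal{C}_d^s(n)$ is the family of all $X\subset\mathbb{R}^d$ with $|X|=n$, $\operatorname{aff}X=\mathbb{R}^d$, $X$ in strictly convex position, and $\underline{sa}_d^s(n):=\min\{sa(X)\mid X\in\mathcal{C}_d^s(n)\}$. The $\Theta(\cdot)$ relation means that the explicit expression lies between positive absolute constant multiples of $(d-k)d$, over the stated range of $d,k$. *)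

(* Defs.v *)
From HB Require Import structures.
From mathcomp Require Import all_boot all_order all_algebra.
From mathcomp Require Import finmap.
From mathcomp Require Import boolp classical_sets functions reals convex.

Set Implicit Arguments.
Unset Strict Implicit.
Unset Printing Implicit Defensive.

Import Order.TTheory GRing.Theory Num.Theory.

Local Open Scope classical_set_scope.
Local Open Scope ring_scope.

Section Geometry.
Context {R : realType} {d : nat}.
Implicit Types (A P H : set 'rV[R]_d) (X : {fset 'rV[R]_d}).

Definition dotv (u v : 'rV[R]_d) : R := (u *m v^T) 0 0.

Definition conv_hull A : set 'rV[R]_d :=
  smallest (@convex_set R 'rV[R]_d) A.

Definition affine_set A : Prop :=
  forall (x y : 'rV[R]_d) (t : R), A x -> A y -> A (t *: x + (1 - t) *: y).

Definition aff_hull A : set 'rV[R]_d := smallest affine_set A.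

Definition hyperplane (u : 'rV[R]_d) (c : R) : set 'rV[R]_d :=
  [set y | dotv u y = c].

(* [u] may be replaced by [- u], so the inequality may point either way. *)
Definition supporting_hyperplane P H : Prop :=
  exists u c, [/\ u != 0, H = hyperplane u c, P `&` H !=set0
                & P `<=` [set y | dotv u y <= c]].

(* Two hyperplanes are parallel iff they have a common normal vector; equal
   hyperplanes count as parallel. *)
Definition parallel H1 H2 : Prop :=
  exists u c1 c2, [/\ u != 0, H1 = hyperplane u c1 & H2 = hyperplane u c2].

(* The vertices of a polytope are its zero-dimensional faces. *)
Definition vert P : set 'rV[R]_d :=
  [set v | exists2 H, supporting_hyperplane P H & P `&` H = [set v]].

Definition strictly_convex_position X : Prop :=
  [set` X] = vert (conv_hull [set` X]).

Definition strictly_antipodal X (x y : 'rV[R]_d) : Prop :=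
  [/\ x \in X, y \in X, x != y & exists H1 H2,
      [/\ supporting_hyperplane (conv_hull [set` X]) H1,
          supporting_hyperplane (conv_hull [set` X]) H2,
          parallel H1 H2 /\ H1 <> H2,
          [set` X] `&` H1 = [set x] & [set` X] `&` H2 = [set y]]].

(* Unordered pairs are counted as two-element subsets of [X]. *)
Definition sa X : nat :=
  #|` [fset e in fpowerset X |
        `[< exists x y, strictly_antipodal X x y /\ e = [fset x; y] >] ]|%fset.

End Geometry.

Definition strictly_convex_family (R : realType) (d n : nat) :
    set {fset 'rV[R]_d} :=
  [set X | [/\ #|` X|%fset = n, aff_hull [set` X] = setT
             & strictly_convex_position X]].
Arguments strictly_convex_family : clear implicits.

(* The minimum of a set of natural numbers, with value 0 on the empty set. *)
Definition min_nat (S : set nat) : nat := xget 0%N (S `&` lbound S).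

Definition sa_min (R : realType) (d n : nat) : nat :=
  min_nat [set sa X | X in strictly_convex_family R d n].

(* Main.v *)
Require Import Defs.
From mathcomp Require Import all_boot all_order all_algebra.
From mathcomp Require Import reals.
From mathcomp Require Import finmap.
From mathcomp Require Import boolp classical_sets interval_inference convex.
From mathcomp Require Import zify ring lra.

(** Write n = d + k. The bound is sa(X) >= C(d+1,2) - C(k,2), and the proof is
    by induction on d. Choose a strictly antipodal pair i, j, project X along the
    line ij, and let X' be the vertex set of the shadow of conv X. It lies in
    dimension d - 1, and its strictly antipodal pairs lift to X.

    Suppose a linear functional y takes one value on i, j and all their mates.
    Start from a generic functional u with maximum only at i and minimum only
    at j, and move along u + ty. The first point to reach the maximum or the
    minimum would be a new mate with a different value of y, unless some x
    reaches the maximum exactly when some z reaches the minimum; by genericity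
    this requires x - i and j - z to be parallel.

    If i, j project to a vertex p of the shadow, no such x, z exist, as p would
    lie between their images. So the images of the mates span, giving at least
    d - 1 fibres, and the fibres over mates of p contribute two pairs each. This
    gains d pairs, while |X'| <= n - 1. Otherwise |X'| <= n - 2, and as each
    parallel pair x, z makes one point redundant for spanning, the points i and
    j have at least d - k other mates in total: the gain is d - k + 1. *)

Set Implicit Arguments.
Unset Strict Implicit.
Unset Printing Implicit Defensive.

Import Order.TTheory GRing.Theory Num.Theory.

Local Open Scope ring_scope.

(** * The dot product and its bilinearity *)

Section Dot.
Context {R : realType} {d : nat}.
Implicit Types u v w x y z : 'rV[R]_d.

Lemma dotvDl u v w : dotv (u + v) w = dotv u w + dotv v w.
Proof. by rewrite /dotv mulmxDl mxE. Qed.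

Lemma dotvZl a u w : dotv (a *: u) w = a * dotv u w.
Proof. by rewrite /dotv -scalemxAl mxE. Qed.

Lemma dotvC u v : dotv u v = dotv v u.
Proof. by rewrite /dotv !mxE; apply: eq_bigr => i _; rewrite !mxE mulrC. Qed.

Lemma dotvNl u w : dotv (- u) w = - dotv u w.
Proof. by rewrite -scaleN1r dotvZl mulN1r. Qed.

Lemma dotvBl u v w : dotv (u - v) w = dotv u w - dotv v w.
Proof. by rewrite dotvDl dotvNl. Qed.

Lemma dotvDr u v w : dotv w (u + v) = dotv w u + dotv w v.
Proof. by rewrite !(dotvC w) dotvDl. Qed.

Lemma dotvZr a u w : dotv w (a *: u) = a * dotv w u.
Proof. by rewrite !(dotvC w) dotvZl. Qed.

Lemma dotvBr u v w : dotv w (u - v) = dotv w u - dotv w v.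
Proof. by rewrite !(dotvC w) dotvBl. Qed.

Lemma dot0v w : dotv 0 w = 0.
Proof. by rewrite -(scale0r 0) dotvZl mul0r. Qed.

Lemma dotv0 w : dotv w 0 = 0.
Proof. by rewrite dotvC dot0v. Qed.

Lemma dotvv_gt0 u : u != 0 -> 0 < dotv u u.
Proof.
move=> u0; rewrite /dotv mxE lt_def sumr_ge0 ?andbT; last first.
  by move=> i _; rewrite mxE -expr2 sqr_ge0.
apply: contra u0; rewrite psumr_eq0; last first.
  by move=> i _; rewrite mxE -expr2 sqr_ge0.
move=> /allP u0; apply/eqP/rowP => i; rewrite [RHS]mxE.
by have := u0 i (mem_index_enum _); rewrite mxE -expr2 sqrf_eq0 => /eqP.
Qed.

End Dot.

(** * Perturbation of linear functionals *)

Section Perturbation.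
Context {R : realType} {d : nat}.
Implicit Types (u v y a : 'rV[R]_d) (s pos nz : seq 'rV[R]_d).

(** A finite list leaves room for one small [e], so [y + e *: v] realises the lexicographic order
    given by [y] and then [v]. *)
Lemma lex_perturb s y v : exists2 e : R, 0 < e &
  forall a, a \in s ->
    0 < dotv y a \/ dotv y a = 0 /\ 0 < dotv v a -> 0 < dotv (y + e *: v) a.
Proof.
(* Asking for every [e'] up to [e] lets the induction shrink [e] freely. *)
suff [e e0 H] : exists2 e : R, 0 < e & forall e', 0 < e' <= e ->
    forall a, a \in s -> 0 < dotv y a \/ dotv y a = 0 /\ 0 < dotv v a ->
    0 < dotv (y + e' *: v) a.
  by exists e => // a; apply: H; rewrite e0 lexx.
elim: s => [|a s [e e0 IH]]; first by exists 1.
have n0 : 0 < 1 + `|dotv v a| by rewrite ltr_pwDl.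
have [ya|ya] := ltP 0 (dotv y a).
  (* The summand 1 in the denominator keeps it positive and makes the resulting inequality
     strict. *)
  exists (Num.min e (dotv y a / (1 + `|dotv v a|))).
    by rewrite lt_min e0 divr_gt0.
  move=> e' /andP[e'0]; rewrite le_min => /andP[e'e].
  rewrite ler_pdivlMr // => e'y b; rewrite inE => /predU1P[->|bs]; last first.
    by apply: IH => //; rewrite e'0.
  move=> _; rewrite dotvDl dotvZl.
  have := ler_norm (- dotv v a); rewrite normrN => h.
  by have := ler_wpM2l (ltW e'0) h; lra.
exists e => // e' e'e b; rewrite inE => /predU1P[->|bs]; last exact: IH.
move=> [|[ya0 va]]; first by rewrite ltNge ya.
by case/andP: e'e => e'0 _; rewrite dotvDl dotvZl ya0 add0r mulr_gt0.
Qed.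

(** Each [a] in [nz] gets its sign fixed in turn: [u] is tilted towards [a] if it vanishes there,
    and then [a] or [- a] joins [pos], so that later tilts preserve the sign. *)
Lemma generic_perturb pos nz u :
  (forall a, a \in pos -> 0 < dotv u a) -> (forall a, a \in nz -> a != 0) ->
  exists2 v, forall a, a \in pos -> 0 < dotv v a
           & forall a, a \in nz -> dotv v a != 0.
Proof.
elim: nz pos u => [|a nz IH] pos u upos nz0; first by exists u.
have nz0' b : b \in nz -> b != 0 by move=> bn; rewrite nz0 // inE bn orbT.
suff [v [b [ba vpos]]] : exists v b, (b = a \/ b = - a) /\
    forall x, x \in b :: pos -> 0 < dotv v x.
  have [v' v'pos v'nz] := IH _ _ vpos nz0'.
  exists v' => [x xp|x]; first by rewrite v'pos // inE xp orbT.
  rewrite inE => /predU1P[->|]; last exact: v'nz.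
  have := v'pos b; rewrite mem_head => /(_ isT); case: ba => -> h.
    by rewrite gt_eqF.
  by rewrite dotvC lt_eqF // -oppr_gt0 -dotvNl dotvC.
have [ua|ua|ua] := ltgtP 0 (dotv u a).
- exists u, a; split; first by left.
  by move=> x; rewrite inE => /predU1P[->|/upos].
- exists u, (- a); split; first by right.
  move=> x; rewrite inE => /predU1P[->|/upos//].
  by rewrite dotvC dotvNl dotvC oppr_gt0.
have [e e0 He] := lex_perturb pos u a.
exists (u + e *: a), a; split; first by left.
move=> x; rewrite inE => /predU1P[->|xp]; last first.
  by apply: He => //; left; apply: upos.
rewrite dotvDl dotvZl -ua add0r mulr_gt0 // dotvv_gt0 //.
by rewrite nz0 // mem_head.
Qed.

Lemma seq_argmax (T : eqType) (X : seq T) (f : T -> R) x0 : x0 \in X ->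
  exists2 x, x \in X & forall z, z \in X -> f z <= f x.
Proof.
elim: X x0 => // x X IH x0 _; case: X IH => [|x1 X] IH.
  by exists x; rewrite ?mem_head // => z; rewrite inE => /eqP ->.
have [x' x'X x'max] := IH x1 (mem_head _ _).
have [le|/ltW le] := leP (f x) (f x').
  exists x' => [|z]; first by rewrite in_cons x'X orbT.
  by rewrite in_cons => /predU1P[-> //|]; apply: x'max.
exists x; rewrite ?mem_head // => z; rewrite in_cons => /predU1P[-> //|zX].
exact: le_trans (x'max _ zX) le.
Qed.

End Perturbation.

(** * Exposed points and antipodal pairs in terms of linear functionals *)

Section Peaks.
Context {R : realType} {d : nat}.
Implicit Types (u v x y z : 'rV[R]_d) (X Y Z nz : seq 'rV[R]_d).

Definition peak X u x := forall z, z \in X -> z != x -> dotv u z < dotv u x.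

Definition exposed X x := exists u, peak X u x.

(** The two parallel supporting hyperplanes are encoded by their common normal [u]. *)
Definition antipodal X x y := [/\ x \in X, y \in X, x != y &
  exists u, peak X u x /\ peak X (- u) y].

(** Dual form of the condition that no hyperplane contains [X]. *)
Definition spanning X := forall u,
  (forall x y, x \in X -> y \in X -> dotv u x = dotv u y) -> u = 0.

Definition separates X u := forall x z, x \in X -> z \in X -> x != z ->
  dotv u x != dotv u z.

Lemma antipodal_sym X x y : antipodal X x y -> antipodal X y x.
Proof.
move=> [xX yX xy [u [ux uy]]]; split=> //; first by rewrite eq_sym.
by exists (- u); rewrite opprK.
Qed.

Lemma peakN X u x : peak X (- u) x <->
  forall z, z \in X -> z != x -> dotv u x < dotv u z.
Proof.
by split=> h z zX zx; have := h z zX zx; rewrite !dotvNl ltrN2.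
Qed.

(** [y] exposes opposite faces containing [x] and [z], and [v] breaks the ties in both; one small
    multiple of [v] serves both faces. *)
Lemma lex_antipodal X y v x z : x \in X -> z \in X -> x != z ->
  (forall t, t \in X -> t != x -> dotv y t < dotv y x \/
     dotv y t = dotv y x /\ dotv v t < dotv v x) ->
  (forall t, t \in X -> t != z -> dotv y z < dotv y t \/
     dotv y z = dotv y t /\ dotv v z < dotv v t) ->
  antipodal X x z.
Proof.
move=> xX zX xz hx hz; split=> //.
pose ds := [seq p.1 - p.2 | p <- [seq (a, b) | a <- X, b <- X]].
have [e e0 He] := lex_perturb ds y v.
have mem a b : a \in X -> b \in X -> a - b \in ds.
  move=> aX bX; apply/mapP; exists (a, b) => //.
  by apply/allpairsP; exists (a, b).
exists (y + e *: v); split.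
  move=> t tX tx; rewrite -subr_gt0 -dotvBr; apply: He; first exact: mem.
  rewrite !dotvBr !subr_gt0.
  by case: (hx t tX tx) => [|[->]]; rewrite ?subrr; auto.
apply/peakN => t tX tz; rewrite -subr_gt0 -dotvBr; apply: He; first exact: mem.
rewrite !dotvBr !subr_gt0.
by case: (hz t tX tz) => [|[->]]; rewrite ?subrr; auto.
Qed.

(** Exposing [i] and [j] is an open condition on [u], so finitely many hyperplanes of functionals
    can be avoided. *)
Lemma antipodal_generic X i j nz : antipodal X i j ->
  (forall a, a \in nz -> a != 0) ->
  exists u, [/\ peak X u i, peak X (- u) j, separates X u
              & forall a, a \in nz -> dotv u a != 0].
Proof.
move=> [iX jX ij [u [ui uj]]] nz0.
pose pos := [seq i - z | z <- X & z != i] ++ [seq z - j | z <- X & z != j].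
pose ds := [seq p.1 - p.2 | p <- [seq (a, b) | a <- X, b <- X] & p.1 != p.2].
have [||v vpos vnz] := @generic_perturb R d pos (ds ++ nz) u.
- move=> a; rewrite mem_cat => /orP[] /mapP[z]; rewrite mem_filter => /andP[zi zX] ->;
    rewrite dotvBr subr_gt0; first exact: ui.
  by move/peakN: uj; apply.
- move=> a; rewrite mem_cat => /orP[/mapP[[b c]]|/nz0//].
  by rewrite mem_filter => /andP[/= bc _] ->; rewrite subr_eq0.
exists v; split.
- move=> z zX zi; rewrite -subr_gt0 -dotvBr vpos // mem_cat.
  by apply/orP; left; apply/mapP; exists z; rewrite // mem_filter zi.
- apply/peakN => z zX zj; rewrite -subr_gt0 -dotvBr vpos // mem_cat.
  by apply/orP; right; apply/mapP; exists z; rewrite // mem_filter zj.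
- move=> x z xX zX xz; rewrite -subr_eq0 -dotvBr vnz // mem_cat.
  apply/orP; left; apply/mapP; exists (x, z) => //; rewrite mem_filter xz /=.
  by apply/allpairsP; exists (x, z).
by move=> a an; rewrite vnz // mem_cat an orbT.
Qed.

Lemma separating_refinement Z u : exists v, separates Z v /\
  forall x z, x \in Z -> z \in Z -> dotv u x < dotv u z -> dotv v x < dotv v z.
Proof.
pose ds := [seq p.1 - p.2 | p <- [seq (a, b) | a <- Z, b <- Z] & p.1 != p.2].
have mem a b : a \in Z -> b \in Z -> a != b -> a - b \in ds.
  move=> aX bX ab; apply/mapP; exists (a, b) => //.
  by rewrite mem_filter ab; apply/allpairsP; exists (a, b).
have [//||g _ gnz] := @generic_perturb R d [::] ds 0.
  move=> a /mapP[[b c]].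
  by rewrite mem_filter => /andP[/= bc _] ->; rewrite subr_eq0.
have [e e0 He] := lex_perturb ds u g.
have lt x z : x \in Z -> z \in Z -> dotv u x < dotv u z \/
    dotv u x = dotv u z /\ dotv g x < dotv g z ->
    dotv (u + e *: g) x < dotv (u + e *: g) z.
  move=> xZ zZ h; rewrite -subr_gt0 -dotvBr; apply: He.
    by apply: mem => //; apply/eqP => zx; case: h => [|[_]]; rewrite zx ltxx.
  by rewrite !dotvBr !subr_gt0; case: h => [|[->]]; rewrite ?subrr; auto.
exists (u + e *: g); split=> [x z xZ zZ xz|x z xZ zZ h]; last by apply: lt; auto.
have gxz := gnz _ (mem _ _ xZ zZ xz); rewrite dotvBr subr_eq0 in gxz.
have [h|h|h] := ltgtP (dotv u x) (dotv u z).
- by rewrite lt_eqF // lt //; left.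
- by rewrite gt_eqF // lt //; left.
case: (ltgtP (dotv g x) (dotv g z)) gxz => // h' _.
- by rewrite lt_eqF // lt //; right.
- by rewrite gt_eqF // lt //; right.
Qed.

(** The maximum of a separating refinement of [u] is attained once, hence at an exposed point, and
    the refinement never reverses a strict inequality of [u]. *)
Lemma exposed_above Z u z : z \in Z ->
  exists x, [/\ x \in Z, exposed Z x & dotv u z <= dotv u x].
Proof.
move=> zZ; have [v [vsep vlt]] := separating_refinement Z u.
have [x xZ xmax] := seq_argmax (dotv v) zZ.
exists x; split=> //.
  exists v => t tZ tx; have := vsep _ _ tZ xZ tx.
  by rewrite lt_neqAle => ->; exact: xmax.
by rewrite leNgt; apply/negP => /(vlt _ _ xZ zZ); rewrite ltNge xmax.
Qed.

(** If [z] were at least as high as [a], a slight tilt of [u] towards [z - a] would put [z] above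
    [a] but keep [a] above the other points of [Y]; an exposed point at least as high as [z]
    contradicts this. *)
Lemma peak_of_exposed Z Y u a : {subset Y <= Z} -> a \in Z ->
  (forall x, x \in Z -> exposed Z x -> x \in Y) ->
  peak Y u a -> peak Z u a.
Proof.
move=> YZ aZ ZY ua z zZ za; rewrite ltNge; apply/negP => uaz.
have [e e0 He] := lex_perturb ((z - a) :: [seq a - x | x <- Y]) u (z - a).
have h : 0 < dotv (u + e *: (z - a)) (z - a).
  rewrite dotvDl dotvZl dotvBr ltr_wpDl ?subr_ge0 // mulr_gt0 // dotvv_gt0 //.
  by rewrite subr_eq0.
have [x [xZ xe hx]] := exposed_above (u + e *: (z - a)) zZ.
have [xa|xa] := eqVneq x a.
  by move: h; rewrite dotvBr subr_gt0 => /lt_le_trans/(_ hx); rewrite xa ltxx.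
have xY := ZY _ xZ xe.
have : 0 < dotv (u + e *: (z - a)) (a - x).
  apply: He; last by left; rewrite dotvBr subr_gt0 ua.
  by rewrite in_cons; apply/orP; right; apply/mapP; exists x.
move: h; rewrite !dotvBr !subr_gt0 => h1 h2.
by have := lt_trans (lt_le_trans h1 hx) h2; rewrite ltxx.
Qed.

Lemma exists_antipodal X x0 x1 : x0 \in X -> x1 \in X -> x0 != x1 ->
  exists i j, antipodal X i j.
Proof.
move=> x0X x1X x01; have [v [vsep _]] := separating_refinement X 0.
have [i iX imax] := seq_argmax (dotv v) x0X.
have [j jX jmax] := seq_argmax (dotv (- v)) x0X.
have pi : peak X v i.
  by move=> t tX ti; rewrite lt_neqAle vsep //= imax.
have pj : peak X (- v) j.
  by move=> t tX tj; rewrite lt_neqAle jmax // !dotvNl eqr_opp vsep.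
exists i, j; split=> //; last by exists v.
apply/eqP => ij; move: x01.
suff h x : x \in X -> x = i by rewrite (h x0) // (h x1) // eqxx.
move=> xX; apply/eqP/negPn/negP => xi.
move/peakN/(_ x xX): pj; rewrite -ij xi => /(_ isT) h.
by have := pi _ xX xi; rewrite ltNge ltW.
Qed.

End Peaks.

(** * Mates of an antipodal pair and first contacts *)

Section Mates.
Context {R : realType} {d : nat}.
Implicit Types (u v x y z : 'rV[R]_d) (X : seq 'rV[R]_d).

(** The ratio for [x] is the time [t] at which [x] reaches the level of [i] under [u + t *: y]. No
    point is higher then, [j] is still the only lowest point, and a functional exposing [x] breaks
    the tie at the top. *)
Lemma antipodal_of_first_contact X i j u y x :
    (forall x, x \in X -> exposed X x) -> i \in X -> j \in X ->
    peak X u i -> peak X (- u) j -> dotv y j = dotv y i ->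
    x \in X -> dotv y i < dotv y x ->
    (forall z, z \in X -> dotv y i < dotv y z ->
       (dotv u i - dotv u x) / (dotv y x - dotv y i)
         <= (dotv u i - dotv u z) / (dotv y z - dotv y i)) ->
    (forall z, z \in X -> dotv y z < dotv y i ->
       (dotv u i - dotv u x) / (dotv y x - dotv y i)
         < (dotv u z - dotv u j) / (dotv y i - dotv y z)) ->
  antipodal X j x.
Proof.
move=> Xexp iX jX ui /peakN uj yj xX yx xmin zmin; apply: antipodal_sym.
set t := (_ / _) in xmin zmin.
have xi : x != i by apply: contraTneq yx => ->; rewrite ltxx.
have yx0 : 0 < dotv y x - dotv y i by rewrite subr_gt0.
have t0 : 0 < t by rewrite divr_gt0 // subr_gt0 ui.
have tx : t * (dotv y x - dotv y i) = dotv u i - dotv u x.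
  by rewrite /t divfK // gt_eqF.
have [v vx] := Xexp x xX.
apply: (@lex_antipodal _ _ X (u + t *: y) v) => //.
- by apply: contraTneq yx => ->; rewrite yj ltxx.
- move=> z zX zx; rewrite !dotvDl !dotvZl.
  have uz : dotv u z <= dotv u i.
    by have [->//|zi] := eqVneq z i; exact: ltW (ui z zX zi).
  suff : dotv u z + t * dotv y z <= dotv u x + t * dotv y x.
    rewrite le_eqVlt => /orP[/eqP ->|]; last by left.
    by right; split=> //; exact: vx.
  have [yz|yz] := ltP (dotv y i) (dotv y z).
    have := xmin z zX yz; rewrite ler_pdivlMr ?subr_gt0 //; lra.
  by have := ler_wpM2l (ltW t0) yz; lra.
move=> z zX zj; left; rewrite !dotvDl !dotvZl yj.
have [yz|yz] := ltP (dotv y z) (dotv y i).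
  have := zmin z zX yz; rewrite ltr_pdivlMr ?subr_gt0 //; lra.
by have := ler_wpM2l (ltW t0) yz; have := uj z zX zj; lra.
Qed.

(* Start from a generic [u] exposing [i] and [j] and move to [u + t y]: the first
   points to enter the top or the bottom face are new mates of [j] or of [i],
   unless both faces grow at the same time, which genericity only allows when
   [x - i] and [j - z] are parallel. *)
Lemma simultaneous_contact X i j y :
    (forall x, x \in X -> exposed X x) -> antipodal X i j ->
    (forall t, antipodal X i t -> dotv y t = dotv y i) ->
    (forall t, antipodal X j t -> dotv y t = dotv y i) ->
    (exists2 x, x \in X & dotv y x != dotv y i) ->
  exists x z, [/\ x \in X, z \in X, dotv y i < dotv y x, dotv y z < dotv y i &
    (dotv y i - dotv y z) *: (i - x) = (dotv y x - dotv y i) *: (z - j)].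
Proof.
move=> Xexp ij yi yj [x0 x0X x0i]; apply: contrapT => no.
have [iX jX neij _] := ij; have yji := yi j ij.
(* [f x z] vanishes exactly when the wanted identity holds, and [u] is chosen nonzero on all other
   values of [f]. *)
pose f x z := (dotv y i - dotv y z) *: (i - x) - (dotv y x - dotv y i) *: (z - j).
pose nz := [seq f p.1 p.2 |
  p <- [seq (x, z) | x <- X, z <- X] & f p.1 p.2 != 0].
have [|u [ui uj _ unz]] := @antipodal_generic _ _ X i j nz ij.
  by move=> a /mapP[p]; rewrite mem_filter => /andP[? _] ->.
pose Pos := [seq x <- X | dotv y i < dotv y x].
pose Neg := [seq x <- X | dotv y x < dotv y i].
have PosE x : x \in X -> dotv y i < dotv y x -> x \in Pos.
  by rewrite mem_filter => -> ->.
have NegE x : x \in X -> dotv y x < dotv y i -> x \in Neg.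
  by rewrite mem_filter => -> ->.
(* [a] and [b] are the times at which a point reaches the level of [i] or of [j] under
   [u + t *: y]. *)
pose a x := (dotv u i - dotv u x) / (dotv y x - dotv y i).
pose b z := (dotv u z - dotv u j) / (dotv y i - dotv y z).
have top x : x \in Pos -> (forall z, z \in Pos -> a x <= a z) ->
    (forall z, z \in Neg -> a x < b z) -> False.
  rewrite mem_filter => /andP[yx xX] hP hN.
  suff /yj yxi : antipodal X j x by rewrite yxi ltxx in yx.
  apply: (@antipodal_of_first_contact X i j u y x) => // z zX yz.
    by apply/hP/PosE.
  by apply/hN/NegE.
(* The mirror image of [top], with [u] and [y] negated and [i] and [j] exchanged. *)
have bot z : z \in Neg -> (forall x, x \in Neg -> b z <= b x) ->
    (forall x, x \in Pos -> b z < a x) -> False.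
  rewrite mem_filter => /andP[yz zX] hN hP.
  suff /yi yzi : antipodal X i z by rewrite yzi ltxx in yz.
  have ui' : peak X (- - u) i by rewrite opprK.
  apply: (@antipodal_of_first_contact X j i (- u) (- y) z) => //.
  - by rewrite !dotvNl yji.
  - by rewrite !dotvNl yji ltrN2.
  - move=> x xX; rewrite !dotvNl yji ltrN2 => yx.
    by have := hN x (NegE x xX yx); rewrite /b !opprK ![- _ + _]addrC.
  move=> x xX; rewrite !dotvNl yji ltrN2 => yx.
  by have := hP x (PosE x xX yx); rewrite /a /b !opprK ![- _ + _]addrC.
have amin x1 : x1 \in Pos ->
    exists2 x, x \in Pos & forall z, z \in Pos -> a x <= a z.
  move=> x1P; have [x xP xm] := seq_argmax (fun x => - a x) x1P.
  by exists x => // z /xm; rewrite lerN2.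
have bmin x1 : x1 \in Neg ->
    exists2 x, x \in Neg & forall z, z \in Neg -> b x <= b z.
  move=> x1P; have [x xP xm] := seq_argmax (fun x => - b x) x1P.
  by exists x => // z /xm; rewrite lerN2.
have [[x1 /amin[x xP xm]]|P0] := pselect (exists x, x \in Pos); last first.
  have /bmin[z zN zm] : x0 \in Neg.
    apply: NegE => //; rewrite lt_neqAle x0i leNgt /=.
    by apply/negP => ?; apply: P0; exists x0; apply: PosE.
  by apply: (bot z zN zm) => x xP; case: P0; exists x.
have [[z1 /bmin[z zN zm]]|N0] := pselect (exists z, z \in Neg); last first.
  by apply: (top x xP xm) => z zN; case: N0; exists z.
case: (ltgtP (a x) (b z)) => ab.
- by apply: (top x xP xm) => z' /zm; apply: lt_le_trans.
- by apply: (bot z zN zm) => x' /xm; apply: lt_le_trans.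
(* A tie [a x = b z] says that [u] kills [f x z], so by the choice of [u] this vector is 0. *)
move: xP zN; rewrite !mem_filter => /andP[yx xX] /andP[yz zX].
apply: no; exists x, z; split=> //; apply/eqP; rewrite -subr_eq0.
apply: contraT => fxz; suff /unz : f x z \in nz.
  have {}ab : (dotv u i - dotv u x) * (dotv y i - dotv y z) =
      (dotv u z - dotv u j) * (dotv y x - dotv y i).
    by apply/eqP; rewrite -eqr_div; [exact/eqP | lra | lra].
  by rewrite /f dotvBr !dotvZr !dotvBr [X in X - _]mulrC ab mulrC subrr eqxx.
apply/mapP; exists (x, z) => //; rewrite mem_filter fxz.
by apply/allpairsP; exists (x, z).
Qed.

End Mates.

(** * Annihilators and projection along a line *)

Section Linear.
Context {R : realType}.

Lemma annihilator_exists d (s : seq 'rV[R]_d) : (size s < d)%N ->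
  exists2 u, u != 0 & forall v, v \in s -> dotv u v = 0.
Proof.
move=> sd; pose M := \matrix_(i < size s) tnth (in_tuple s) i.
have /rowV0Pn[u /sub_kermxP uM u0] : kermx M^T != 0.
  rewrite -mxrank_eq0 mxrank_ker mxrank_tr subn_eq0 -ltnNge.
  exact: leq_ltn_trans (rank_leq_row _) sd.
exists u => // v /(nthP 0)[i i_s <-].
have /matrixP/(_ 0 (Ordinal i_s)) := uM; rewrite [RHS]mxE => <-.
rewrite /dotv !mxE; apply: eq_bigr => k _; rewrite !mxE; congr (_ * _).
by rewrite (tnth_nth 0).
Qed.

(** The columns of [A] form a basis of the orthogonal complement of [w]; a rank count then shows
    that its kernel is the line of [w]. *)
Lemma projection_along d (w : 'rV[R]_d.+1) : w != 0 ->
  exists A : 'M[R]_(d.+1, d), [/\ w *m A = 0,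
    forall x, x *m A = 0 -> exists c, x = c *: w
  & forall y : 'rV_d, y *m A^T = 0 -> y = 0].
Proof.
move=> w0; have rw : \rank w = 1%N.
  by apply/eqP; rewrite eqn_leq rank_leq_row lt0n mxrank_eq0.
have rk : \rank (kermx w^T) = d.
  by rewrite mxrank_ker mxrank_tr rw subn1.
(* Stated as an existence so that [rk] can rewrite the number of rows. *)
have : exists B : 'M[R]_(\rank (kermx w^T), d.+1), row_free B /\ B *m w^T = 0.
  exists (row_base (kermx w^T)); rewrite row_base_free; split=> //.
  by apply/sub_kermxP; rewrite eq_row_base.
rewrite rk => -[B [Bfree Bw]].
exists B^T; split.
- by apply: trmx_inj; rewrite trmx_mul trmxK Bw trmx0.
- move=> x /sub_kermxP xB; suff /sub_rVP[c ->] : (x <= w)%MS by exists c.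
  apply: submx_trans xB _; rewrite -(geq_leqif (mxrank_leqif_sup _)).
    by rewrite mxrank_ker mxrank_tr (eqP Bfree) rw subSnn.
  by apply/sub_kermxP/trmx_inj; rewrite trmx_mul trmxK Bw trmx0.
- by move=> y; rewrite trmxK => /eqP; rewrite mulmx_free_eq0 // => /eqP.
Qed.

(** [u *m A^T] is the pullback of the functional [u] along the projection. *)
Lemma dotv_mulmx d e (u : 'rV[R]_d) (x : 'rV_e) (A : 'M_(e, d)) :
  dotv (u *m A^T) x = dotv u (x *m A).
Proof. by rewrite /dotv trmx_mul mulmxA. Qed.

End Linear.

(** * Counting ordered pairs *)

Section Counting.

Lemma sum_pairs (T : eqType) (A B : seq T) (g : rel T) :
  (\sum_(x <- A) \sum_(y <- B) g x y = 
    size [seq q <- [seq (x, y) | x <- A, y <- B] | g q.1 q.2])%N.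
Proof.
rewrite size_filter -sum1_count [RHS]big_mkcond big_allpairs /=.
by apply: eq_bigr => x _; apply: eq_bigr => y _; case: (g x y).
Qed.

Lemma size_le_preimages (S T : eqType) (A : seq T) (B : seq S) (f : S -> T) :
  uniq A -> (forall a, a \in A -> exists2 x, x \in B & f x = a) ->
  (size A <= size B)%N.
Proof.
move=> uA h; rewrite -(size_map f B); apply: uniq_leq_size => // a /h[x xB <-].
exact: map_f.
Qed.

(** In the graph [g], each edge at [p] is counted from both of its ends. *)
Lemma sum_sym_cons (T : eqType) (X : seq T) (p : T) (g : rel T) :
  uniq X -> p \in X -> symmetric g -> ~~ g p p ->
  (\sum_(x <- X) \sum_(y <- X) g x y =
    2 * (\sum_(y <- [seq x <- X | x != p]) g p y) +
    \sum_(x <- [seq x <- X | x != p]) \sum_(y <- [seq x <- X | x != p]) g x y)%N.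
Proof.
move=> uX pX gs gp; set X' := filter _ _.
have XX : perm_eq X (p :: X').
  by rewrite (perm_trans (perm_to_rem pX)) // rem_filter.
have E x : (\sum_(y <- X) g x y = g x p + \sum_(y <- X') g x y)%N.
  by rewrite (perm_big _ XX) big_cons.
rewrite (perm_big _ XX) big_cons E (negbTE gp).
rewrite (eq_bigr _ (fun x _ => E x)) big_split /=.
have -> : (\sum_(x <- X') g x p = \sum_(x <- X') g p x)%N.
  by apply: eq_bigr => x _; rewrite gs.
by lia.
Qed.

End Counting.

(** * The shadow along an antipodal pair, and lifting of pairs from it *)

Section Projection.
Context {R : realType} {d : nat} (X : seq 'rV[R]_d.+1) (i j : 'rV[R]_d.+1).
Context (A : 'M[R]_(d.+1, d)).
Context (Xexp : forall x, x \in X -> exposed X x) (Xspan : spanning X).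
Context (Xij : antipodal X i j) (Aij : (i - j) *m A = 0).
Context (kerA : forall x, x *m A = 0 -> exists c, x = c *: (i - j)).
Context (injA : forall y : 'rV_d, y *m A^T = 0 -> y = 0).

Definition shadow := undup [seq x *m A | x <- X].
Definition shadow_vert := [seq a <- shadow | `[< exposed shadow a >]].

Local Notation Z := shadow.
Local Notation X' := shadow_vert.
Local Notation p := (i *m A).

Let jA : j *m A = p.
Proof. by apply/esym/eqP; rewrite -subr_eq0 -mulmxBl Aij. Qed.

Lemma mem_shadow x : x \in X -> x *m A \in Z.
Proof. by move=> xX; rewrite mem_undup (map_f (mulmx^~ A)). Qed.

Lemma shadowP a : a \in Z -> exists2 x, x \in X & x *m A = a.
Proof. by rewrite mem_undup => /mapP[x xX ->]; exists x. Qed.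

Lemma shadow_vert_sub : {subset X' <= Z}.
Proof. by move=> a; rewrite mem_filter => /andP[]. Qed.

Lemma shadow_vert_uniq : uniq X'.
Proof. by rewrite filter_uniq // undup_uniq. Qed.

Lemma mem_shadow_vert a : a \in Z -> exposed Z a -> a \in X'.
Proof. by move=> aZ aexp; rewrite mem_filter aZ andbT; apply/asboolP. Qed.

Lemma shadow_vert_exposed a : a \in X' -> exposed X' a.
Proof.
rewrite mem_filter => /andP[/asboolP[u ua] aZ]; exists u => z zX'.
exact/ua/shadow_vert_sub.
Qed.

(** By [peak_of_exposed], comparison with the vertices of the shadow is enough. *)
Lemma peak_shadow u a : a \in X' -> peak X' u a -> peak Z u a.
Proof.
move=> aX'; apply: peak_of_exposed (shadow_vert_sub) (shadow_vert_sub aX') _.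
exact: mem_shadow_vert.
Qed.

(** Exposed points bound a functional on the shadow from above and below, so one that is constant on
    them has a constant pullback on [X]. *)
Lemma shadow_vert_spanning : spanning X'.
Proof.
move=> u uconst; apply: injA; apply: Xspan.
have le x y : x \in X -> y \in X -> dotv (u *m A^T) x <= dotv (u *m A^T) y.
  move=> xX yX; rewrite !dotv_mulmx.
  have [a [aZ ae ha]] := exposed_above u (mem_shadow xX).
  have [b [bZ be hb]] := exposed_above (- u) (mem_shadow yX).
  rewrite !dotvNl lerN2 in hb; apply: le_trans ha _; apply: le_trans _ hb.
  by rewrite (uconst a b) //; apply: mem_shadow_vert.
by move=> x y xX yX; apply/eqP; rewrite eq_le !le.
Qed.

(** A fibre lies on a line parallel to [i - j], on which [v] is injective. *)
Lemma dotv_fibre v x z : dotv v i != dotv v j -> x *m A = z *m A -> x != z ->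
  dotv v x != dotv v z.
Proof.
move=> vij xz; apply: contra => vxz.
have [c xzE] : exists c, x - z = c *: (i - j).
  by apply: kerA; rewrite mulmxBl xz subrr.
move: vxz; rewrite -subr_eq0 -dotvBr xzE dotvZr mulf_eq0 dotvBr subr_eq0.
by rewrite (negPf vij) orbF => /eqP c0; rewrite -subr_eq0 xzE c0 scale0r.
Qed.

Lemma lift_antipodal a b v x : antipodal X' a b -> dotv v i != dotv v j ->
  x \in X -> x *m A = a ->
  (forall t, t \in X -> t *m A = a -> t != x -> dotv v t < dotv v x) ->
  exists z, [/\ z \in X, z *m A = b & antipodal X x z].
Proof.
move=> [aX' bX' ab [u [ua ub]]] vij xX xa vx.
have {}ua := peak_shadow aX' ua; have {}ub := peak_shadow bX' ub.
have [z0 z0X z0b] := shadowP (shadow_vert_sub bX').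
have z0F : z0 \in [seq t <- X | t *m A == b] by rewrite mem_filter z0b eqxx.
have [z] := seq_argmax (dotv (- v)) z0F.
rewrite mem_filter => /andP[/eqP zb zX] zmax; exists z; split=> //.
apply: (@lex_antipodal _ _ X (u *m A^T) v) => //.
- by apply: contra ab => /eqP xz; rewrite -xa -zb xz.
- move=> t tX tx; rewrite !dotv_mulmx xa.
  have [ta|ta] := eqVneq (t *m A) a; last by left; apply: ua (mem_shadow tX) ta.
  by right; rewrite ta; split=> //; apply: vx.
move=> t tX tz; rewrite !dotv_mulmx zb.
have [tb|tb] := eqVneq (t *m A) b.
  right; rewrite tb; split=> //; rewrite lt_neqAle eq_sym dotv_fibre ?tb ?zb //=.
  by have := zmax t; rewrite mem_filter tb eqxx tX !dotvNl lerN2; apply.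
by left; move/peakN: ub; apply => //; apply: mem_shadow.
Qed.

Lemma lift_antipodal_ex a b : antipodal X' a b ->
  exists x z, [/\ antipodal X x z, x *m A = a & z *m A = b].
Proof.
move=> ab; have [aX' _ _ _] := ab.
have [iX jX ij _] := Xij.
have [v [vsep _]] := separating_refinement X 0.
have vij := vsep _ _ iX jX ij.
have [x0 x0X x0a] := shadowP (shadow_vert_sub aX').
have x0F : x0 \in [seq t <- X | t *m A == a] by rewrite mem_filter x0a eqxx.
have [x] := seq_argmax (dotv v) x0F.
rewrite mem_filter => /andP[/eqP xa xX] xmax.
have [t tX ta tx|z [zX zb xz]] := lift_antipodal ab vij xX xa.
  rewrite lt_neqAle vsep //=; apply: xmax.
  by rewrite mem_filter ta eqxx.
by exists x, z.
Qed.

(** For a functional exposing [i] on top and [j] at the bottom, [i] is the highest point of the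
    fibre over [p]; for its negative, [j] is. So each mate of [p] yields two pairs. *)
Lemma lift_antipodal_ends b : antipodal X' p b ->
  (exists2 z, z *m A = b & antipodal X i z) /\
  (exists2 z, z *m A = b & antipodal X j z).
Proof.
move=> pb; have [iX jX ij [u [ui uj]]] := Xij.
have uij : dotv u i != dotv u j by rewrite gt_eqF // ui // eq_sym.
split.
  have [t tX _|z [zX zb iz]] := lift_antipodal pb uij iX erefl; first exact: ui.
  by exists z.
have uij' : dotv (- u) i != dotv (- u) j by rewrite !dotvNl eqr_opp.
have [t tX _|z [zX zb iz]] := lift_antipodal pb uij' jX jA; first exact: uj.
by exists z.
Qed.

(* If the images of the mates do not span, a functional [y] killing them meets the
   situation of [simultaneous_contact]. *)
Lemma shadow_contact y : y != 0 ->
  (forall t, antipodal X i t -> dotv y (t *m A) = dotv y p) ->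
  (forall t, antipodal X j t -> dotv y (t *m A) = dotv y p) ->
  exists x z a b, [/\ x \in X, z \in X, 0 < a, 0 < b &
    [/\ dotv y (x *m A) != dotv y p, dotv y (z *m A) != dotv y p, x != z
      & b *: (p - x *m A) = a *: (z *m A - p)]].
Proof.
move=> y0 yi yj; have [iX jX ij _] := Xij.
have [|||||x [z [xX zX yx yz xz]]] := @simultaneous_contact _ _ X i j (y *m A^T).
- exact: Xexp.
- exact: Xij.
- by move=> t /yi; rewrite !dotv_mulmx.
- by move=> t /yj; rewrite !dotv_mulmx.
- apply: contrapT => no; move/eqP: y0; apply; apply: injA; apply: Xspan.
  suff h x : x \in X -> dotv (y *m A^T) x = dotv (y *m A^T) i.
    by move=> x z xX zX; rewrite !h.
  by move=> xX; apply: contrapT => /eqP xi; apply: no; exists x.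
exists x, z, (dotv (y *m A^T) x - dotv (y *m A^T) i),
  (dotv (y *m A^T) i - dotv (y *m A^T) z).
rewrite !subr_gt0; split=> //; rewrite -!dotv_mulmx; split.
- by rewrite gt_eqF.
- by rewrite lt_eqF.
- by apply/eqP => xz'; move: yx; rewrite xz' ltNge ltW.
- by have := congr1 (mulmx^~ A) xz; rewrite /= -!scalemxAl !mulmxBl jA.
Qed.

End Projection.

(** Ordered pairs are counted, hence the factors 2 in the estimates. *)
Definition npairs (R : realType) d (X : seq 'rV[R]_d) : nat :=
  \sum_(x <- X) \sum_(y <- X) `[< antipodal X x y >].

(** * Pairs gained over the shadow *)

Section Gain.
Context {R : realType} {d : nat} (X : seq 'rV[R]_d.+1) (i j : 'rV[R]_d.+1).
Context (A : 'M[R]_(d.+1, d)) (uX : uniq X).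
Context (Xexp : forall x, x \in X -> exposed X x) (Xspan : spanning X).
Context (Xij : antipodal X i j) (Aij : (i - j) *m A = 0).
Context (kerA : forall x, x *m A = 0 -> exists c, x = c *: (i - j)).
Context (injA : forall y : 'rV_d, y *m A^T = 0 -> y = 0).

Local Notation Z := (shadow X A).
Local Notation X' := (shadow_vert X A).
Local Notation p := (i *m A).

Let jA : j *m A = p.
Proof. by apply/esym/eqP; rewrite -subr_eq0 -mulmxBl Aij. Qed.

Definition others := [seq x <- [seq x <- X | x != i] | x != j].

(** The pair [i], [j] itself is left out here; it is the summand 1 in [npairs_split]. *)
Definition mates q := [seq t <- others | `[< antipodal X q t >]].

Lemma mem_others x : (x \in others) = [&& x != i, x != j & x \in X].
Proof. by rewrite !mem_filter andbCA. Qed.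

Lemma mem_mates q t : antipodal X q t -> t != i -> t != j -> t \in mates q.
Proof.
move=> qt ti tj; have [_ tX _ _] := qt.
by rewrite mem_filter mem_others ti tj tX (asboolT qt).
Qed.

Lemma perm_others : perm_eq X [:: i, j & others].
Proof.
have [iX jX ij _] := Xij.
apply: perm_trans (perm_to_rem iX) _; rewrite perm_cons rem_filter //.
have jX1 : j \in [seq x <- X | predC1 i x] by rewrite mem_filter /= eq_sym ij.
by apply: perm_trans (perm_to_rem jX1) _; rewrite rem_filter ?filter_uniq.
Qed.

Lemma size_others : size X = (size others).+2.
Proof. by rewrite (perm_size perm_others). Qed.

Lemma asbool_antipodal_sym Y : symmetric (fun x y => `[< @antipodal R d.+1 Y x y >]).
Proof. by move=> x y; apply: asbool_equiv_eq; split; apply: antipodal_sym. Qed.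

Lemma npairs_split : npairs X =
  (2 * (1 + size (mates i) + size (mates j)) +
   \sum_(x <- others) \sum_(y <- others) `[< antipodal X x y >])%N.
Proof.
have [iX jX ij _] := Xij; have gs := @asbool_antipodal_sym X.
have gxx x : ~~ `[< antipodal X x x >].
  by apply/negP => /asboolP[_ _]; rewrite eqxx.
rewrite /npairs (sum_sym_cons uX iX gs) //.
have jX1 : j \in [seq x <- X | x != i] by rewrite mem_filter eq_sym ij.
rewrite (sum_sym_cons (filter_uniq _ uX) jX1 gs) //.
have cnt q : (\sum_(y <- others) `[< antipodal X q y >] = size (mates q))%N.
  rewrite size_filter -sum1_count [RHS]big_mkcond.
  by apply: eq_bigr => y _; case: `[< _ >].
rewrite (perm_big _ (perm_to_rem jX1)) big_cons rem_filter ?filter_uniq //.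
rewrite -[[seq x <- _ | predC1 j x]]/others -/others !cnt.
have -> : `[< antipodal X i j >] by apply/asboolP.
rewrite /=; lia.
Qed.

(** Distinct pairs of the shadow have distinct lifts, and lifts of pairs avoiding [p] avoid [i] and
    [j]. *)
Lemma npairs_others_lift :
  (\sum_(a <- [seq a <- X' | a != p]) \sum_(b <- [seq a <- X' | a != p])
     `[< antipodal X' a b >]
   <= \sum_(x <- others) \sum_(y <- others) `[< antipodal X x y >])%N.
Proof.
rewrite (sum_pairs _ _ (fun a b => `[< antipodal X' a b >])).
rewrite (sum_pairs _ _ (fun a b => `[< antipodal X a b >])).
apply: (@size_le_preimages _ _ _ _ (fun q => (q.1 *m A, q.2 *m A))).
  have uX' := filter_uniq (fun a => a != p) (shadow_vert_uniq X A).
  by apply/filter_uniq/allpairs_uniq => // -[? ?] [? ?].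
move=> [a b]; rewrite mem_filter /= => /andP[/asboolP ab].
move=> /allpairsP[[a' b'] /=]; rewrite !mem_filter => -[/andP[ap _] /andP[bp _] [? ?]].
subst a' b'; have [x [z [xz xa zb]]] := lift_antipodal_ex Xij kerA ab.
have [xX zX _ _] := xz.
have mem t : t \in X -> t *m A != p -> t \in others.
  move=> tX tp; rewrite mem_others tX andbT; apply/andP.
  by split; apply: contraNneq tp => ->; rewrite ?jA.
exists (x, z); last by rewrite /= xa zb.
rewrite mem_filter; apply/andP; split; first exact/asboolP.
by apply/allpairsP; exists (x, z); split; rewrite //= mem // ?xa ?zb.
Qed.

Lemma gain_nonvertex : p \notin X' ->
  (npairs X' + 2 * (1 + size (mates i) + size (mates j)) <= npairs X)%N.
Proof.
move=> pX'; rewrite npairs_split addnC leq_add2l.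
apply: leq_trans npairs_others_lift; suff -> : [seq a <- X' | a != p] = X' by [].
apply/all_filterP/allP => a aX'; by apply: contraNneq pX' => <-.
Qed.

Lemma size_shadow_vert : (size X' < size X)%N.
Proof.
have [iX jX ij _] := Xij; rewrite size_others ltnS -/(size (i :: others)).
apply: (size_le_preimages (f := mulmx^~ A)) (shadow_vert_uniq X A) _ => a.
move=> /shadow_vert_sub/shadowP[x xX <-].
have [->|xi] := eqVneq x i; first by exists i; rewrite ?mem_head.
have [->|xj] := eqVneq x j; first by exists i; rewrite ?mem_head ?jA.
by exists x; rewrite // inE mem_others xi xj xX orbT.
Qed.

Lemma size_shadow_nonvertex : p \notin X' -> (size X' + 2 <= size X)%N.
Proof.
move=> pX'; rewrite size_others addn2 !ltnS.
apply: (size_le_preimages (f := mulmx^~ A)) (shadow_vert_uniq X A) _ => a aX'.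
have [x xX xa] := shadowP (shadow_vert_sub aX'); exists x => //.
rewrite mem_others xX andbT; apply/andP.
by split; apply: contraNneq pX' => xE; move: aX'; rewrite -xa xE ?jA.
Qed.

Lemma spanning_others y : (forall x, x \in others -> dotv y (x *m A) = dotv y p) ->
  y = 0.
Proof.
move=> yc; apply: injA; apply: Xspan.
suff h x : x \in X -> dotv (y *m A^T) x = dotv y p by move=> x z xX zX; rewrite !h.
move=> xX; rewrite dotv_mulmx.
have [->//|xi] := eqVneq x i; have [->|xj] := eqVneq x j; first by rewrite jA.
by apply: yc; rewrite mem_others xi xj.
Qed.

Lemma contact_of_mates y : y != 0 ->
  (forall t, t \in mates i -> dotv y (t *m A) = dotv y p) ->
  (forall t, t \in mates j -> dotv y (t *m A) = dotv y p) ->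
  exists x z a b, [/\ x \in others, z \in others, 0 < a, 0 < b &
    [/\ dotv y (x *m A) != dotv y p, dotv y (z *m A) != dotv y p, x != z
      & b *: (p - x *m A) = a *: (z *m A - p)]].
Proof.
move=> y0 yi yj.
have [||x [z [a [b [xX zX a0 b0 [yx yz xz e]]]]]] :=
    shadow_contact Xexp Xspan Xij Aij injA y0.
- move=> t it; have [->|tj] := eqVneq t j; first by rewrite jA.
  by apply/yi/mem_mates => //; have [_ _] := it; rewrite eq_sym.
- move=> t jt; have [->//|ti] := eqVneq t i.
  by apply/yj/mem_mates => //; have [_ _] := jt; rewrite eq_sym.
exists x, z, a, b; split=> //; rewrite mem_others ?xX ?zX andbT; apply/andP.
  by split; apply: contraNneq yx => ->; rewrite ?jA.
by split; apply: contraNneq yz => ->; rewrite ?jA.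
Qed.

(** The images [I] and [J] of the mates of [i] and of [j] have at least [d] points in their union,
    and the mates of [p] lie in their intersection. The two sizes therefore add up to at least
    [d + size T']. *)
Lemma gain_vertex : p \in X' -> (npairs X' + 2 * d.+1 <= npairs X)%N.
Proof.
move=> pX'.
pose T' := [seq b <- [seq a <- X' | a != p] | `[< antipodal X' p b >]].
suff h : (d + size T' <= size (mates i) + size (mates j))%N.
  have gs : symmetric (fun x y => `[< antipodal X' x y >]).
    by move=> x y; apply: asbool_equiv_eq; split; apply: antipodal_sym.
  rewrite npairs_split /npairs (sum_sym_cons (shadow_vert_uniq X A) pX' gs); last first.
    by apply/negP => /asboolP[_ _]; rewrite eqxx.
  have -> : (\sum_(y <- [seq a <- X' | a != p]) `[< antipodal X' p y >] =
      size T')%N.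
    rewrite size_filter -sum1_count [RHS]big_mkcond.
    by apply: eq_bigr => y _; case: `[< _ >].
  by rewrite addnAC; apply: leq_add npairs_others_lift; lia.
pose I := undup [seq t *m A | t <- mates i].
pose J := undup [seq t *m A | t <- mates j].
have sI : (size I <= size (mates i))%N by rewrite -(size_map (mulmx^~ A)) size_undup.
have sJ : (size J <= size (mates j))%N by rewrite -(size_map (mulmx^~ A)) size_undup.
have sIJ : (size T' <= size [seq a <- J | a \in I])%N.
  apply: uniq_leq_size; first exact/filter_uniq/filter_uniq/shadow_vert_uniq.
  move=> b; rewrite mem_filter => /andP[/asboolP pb]; rewrite mem_filter => /andP[bp _].
  have [[z zb iz] [z' z'b jz']] := lift_antipodal_ends Xij Aij kerA pb.
  have ne t : t *m A = b -> t != i /\ t != j.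
    by move=> tb; split; apply: contraNneq bp => tE; rewrite -tb tE ?jA.
  rewrite mem_filter !mem_undup; apply/andP; split; apply/mapP.
    by exists z => //; have [? ?] := ne z zb; apply: mem_mates.
  by exists z' => //; have [? ?] := ne z' z'b; apply: mem_mates.
suff sU : (d <= size (I ++ [seq a <- J | a \notin I]))%N.
  move: sU sIJ sI sJ; rewrite size_cat !size_filter.
  have : (count (fun a => a \in I) J + count (fun a => a \notin I) J = size J)%N.
    exact: count_predC.
  by lia.
(* With fewer than [d] images, some nonzero [y] would take its value at [p] on all of them. *)
rewrite leqNgt; apply/negP => sU.
have [|y y0 yU] := @annihilator_exists R d
    [seq a - p | a <- I ++ [seq a <- J | a \notin I]]; first by rewrite size_map.
have {}yU a : a \in I ++ [seq a <- J | a \notin I] -> dotv y a = dotv y p.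
  move=> aU; apply/eqP; rewrite -subr_eq0 -dotvBr yU //.
  exact: (map_f (fun a => a - p)).
have [||x [z [a [b [xX zX a0 b0 [yx yz _ e]]]]]] := contact_of_mates y0.
- move=> t ti; apply: yU; rewrite mem_cat mem_undup.
  by rewrite (map_f (mulmx^~ A)).
- move=> t tj; apply: yU; rewrite mem_cat [in _ || _]mem_filter orb_andr orbN /=.
  by rewrite orbC mem_undup (map_f (mulmx^~ A)).
have xXX : x \in X by move: xX; rewrite mem_others => /and3P[].
have zXX : z \in X by move: zX; rewrite mem_others => /and3P[].
(* A functional with its only maximum at the vertex [p] contradicts [e], which places [p] strictly
   between the images of [x] and [z]. *)
have [u up] := shadow_vert_exposed pX'; have {}up := peak_shadow pX' up.
have ux := up _ (mem_shadow A xXX); have uz := up _ (mem_shadow A zXX).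
have {}ux : dotv u (x *m A) < dotv u p by apply: ux; apply: contraNneq yx => ->.
have {}uz : dotv u (z *m A) < dotv u p by apply: uz; apply: contraNneq yz => ->.
have := congr1 (dotv u) e; rewrite !dotvZr !dotvBr.
have : 0 < b * (dotv u p - dotv u (x *m A)) by rewrite mulr_gt0 // subr_gt0.
have : 0 < a * (dotv u p - dotv u (z *m A)) by rewrite mulr_gt0 // subr_gt0.
by lra.
Qed.

(* Each step finds two new points whose images are aligned with [p], so that one of
   them can be dropped from a spanning set. *)
Lemma aligned_pairs r : (r + size (mates i) + size (mates j) <= d)%N ->
  exists xs zs, [/\ size xs = r, size zs = r, uniq (xs ++ zs),
    {subset xs ++ zs <= others} &
    forall y, (forall x, x \in xs -> dotv y (x *m A) = dotv y p) ->
       forall z, z \in zs -> dotv y (z *m A) = dotv y p].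
Proof.
elim: r => [|r IH] hr; first by exists [::], [::].
have [|xs [zs [sx sz uxz sub xzy]]] := IH; first by lia.
have [|y y0 yU] := @annihilator_exists R d
    [seq t *m A - p | t <- xs ++ mates i ++ mates j].
  by rewrite size_map !size_cat sx addnA; exact: hr.
have {}yU t : t \in xs ++ mates i ++ mates j -> dotv y (t *m A) = dotv y p.
  move=> tU; apply/eqP; rewrite -subr_eq0 -dotvBr yU //.
  exact: (map_f (fun t => t *m A - p)).
have [||x [z [a [b [xX zX a0 b0 [yx yz xz e]]]]]] := contact_of_mates y0.
- by move=> t ti; apply: yU; rewrite !mem_cat ti orbT.
- by move=> t tj; apply: yU; rewrite !mem_cat tj !orbT.
have yxs t : t \in xs -> dotv y (t *m A) = dotv y p.
  by move=> tx; apply: yU; rewrite mem_cat tx.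
(* All points found before have the value of [p] under [y]; [x] and [z] do not, so they are new. *)
have new t : dotv y (t *m A) != dotv y p -> t \notin xs ++ zs.
  move=> yt; rewrite mem_cat; apply: contra yt => /orP[tx|tz]; apply/eqP.
    exact: yxs.
  exact: (xzy y yxs).
exists (x :: xs), (z :: zs); split=> /=; rewrite ?sx ?sz //.
- rewrite mem_cat inE (negPf xz) /= -mem_cat new //=.
  by rewrite -cat_rcons -cats1 -catA uniq_catCA /= new.
- move=> t; rewrite inE mem_cat inE => /or3P[/eqP->|tx|/predU1P[->|tz]] //.
    by apply: sub; rewrite mem_cat tx.
  by apply: sub; rewrite mem_cat tz orbT.
move=> y' y'x t; rewrite inE => /predU1P[->|tz]; last first.
  by apply: xzy tz => s sx'; apply: y'x; rewrite inE sx' orbT.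
(* Alignment with [p] forces the value at [z] once the value at [x] is that of [p]. *)
have := congr1 (dotv y') e; rewrite !dotvZr !dotvBr y'x ?mem_head // subrr mulr0.
by move=> /esym/eqP; rewrite mulf_eq0 gt_eqF //= subr_eq0 => /eqP.
Qed.

Lemma mates_nonvertex :
  (d.+1 <= size (mates i) + size (mates j) + (size X - d.+1))%N.
Proof.
pose r := (d - (size (mates i) + size (mates j)))%N.
suff h : (d + r <= size others)%N by rewrite size_others /r in h *; lia.
have [xs [zs [sx sz uxz sub xzy]]] : exists xs zs, [/\ size xs = r, size zs = r,
    uniq (xs ++ zs), {subset xs ++ zs <= others} &
    forall y, (forall x, x \in xs -> dotv y (x *m A) = dotv y p) ->
       forall z, z \in zs -> dotv y (z *m A) = dotv y p].
  (* With more than [d] mates in all, truncated subtraction gives [r = 0]. *)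
  have [rd|/ltnW r0] := leqP (size (mates i) + size (mates j)) d.
    by apply: aligned_pairs; rewrite /r; lia.
  by exists [::], [::]; rewrite /r (eqP r0).
pose rest := [seq x <- others | x \notin zs].
suff h : (d <= size rest)%N.
  have : (count (fun x => x \in zs) others + count (fun x => x \notin zs) others
    = size others)%N by exact: count_predC.
  rewrite -!size_filter -/rest; suff : (r <= size [seq x <- others | x \in zs])%N by lia.
  rewrite -sz; apply: uniq_leq_size; first by move: uxz; rewrite cat_uniq => /and3P[].
  by move=> z zzs; rewrite mem_filter zzs sub // mem_cat zzs orbT.
rewrite leqNgt; apply/negP => srest.
have [|y y0 yU] := @annihilator_exists R d [seq t *m A - p | t <- rest].
  by rewrite size_map.
have {}yU t : t \in rest -> dotv y (t *m A) = dotv y p.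
  move=> tU; apply/eqP; rewrite -subr_eq0 -dotvBr yU //.
  exact: (map_f (fun t => t *m A - p)).
move/eqP: y0; apply; apply: spanning_others => x xo.
have [xz|xz] := boolP (x \in zs); last by apply: yU; rewrite mem_filter xz.
apply: xzy xz => t tx; apply: yU; rewrite mem_filter sub ?mem_cat ?tx // andbT.
move: uxz; rewrite cat_uniq => /and3P[_ /hasPn h _].
by apply/negP => /h; rewrite /= tx.
Qed.

End Gain.

(** * Induction on the dimension *)

Theorem npairs_bound (R : realType) d (X : seq 'rV[R]_d) :
  uniq X -> (forall x, x \in X -> exposed X x) -> spanning X ->
  (2 * 'C(d.+1, 2) <= npairs X + 2 * 'C(size X - d, 2))%N.
Proof.
elim: d X => [|d IH] X uX Xexp Xspan; first by [].
have [x0 [x1 [x0X x1X x01]]] : exists x0 x1, [/\ x0 \in X, x1 \in X & x0 != x1].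
  apply: contrapT => no.
  (* If [X] had at most one point, every functional would be constant on it. *)
  suff : (const_mx 1 : 'rV[R]_d.+1) = 0.
    by move=> /rowP/(_ 0)/eqP; rewrite !mxE oner_eq0.
  apply: Xspan => x y xX yX; have [->//|xy] := eqVneq x y.
  by case: no; exists x, y.
have [i [j Xij]] := exists_antipodal x0X x1X x01.
have ij0 : i - j != 0 by rewrite subr_eq0; case: Xij.
have [A [Aij kerA injA]] := projection_along ij0.
have := IH _ (shadow_vert_uniq X A) (@shadow_vert_exposed _ _ X A)
  (shadow_vert_spanning Xspan injA).
set X' := shadow_vert X A => IHX'.
have sX := mates_nonvertex uX Xexp Xspan Xij Aij injA.
(* The left side grows by [2 * d.+1], which is the gain when the pair projects to a vertex. *)
rewrite (binS d.+1 1) bin1; have [pX'|pX'] := boolP (i *m A \in X').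
  have g := gain_vertex uX Xexp Xspan Xij Aij kerA injA pX'.
  have sX' : (size X' - d <= size X - d.+1)%N.
    by have := size_shadow_vert uX Xij Aij; rewrite -/X'; lia.
  have := leq_bin2l 2 sX'; rewrite -/X' in g *; lia.
have g := gain_nonvertex uX Xij Aij kerA pX'.
have sX' : (size X' - d <= (size X - d.+1).-1)%N.
  by have := size_shadow_nonvertex uX Xij Aij pX'; rewrite -/X'; lia.
have := leq_bin2l 2 sX'; rewrite -/X' in g *.
(* For excess [m.+1] the binomial drops by [m], and the missing [d.+1 - m] pairs are the pair [i],
   [j] and the pairs with mates; for excess 0 the mates alone suffice. *)
case: (size X - d.+1)%N sX => [|m] sX /=; last by rewrite (binS m 1) bin1; lia.
lia.
Qed.

(** * From convex and affine hulls to linear functionals *)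

Section Polytope.
Local Open Scope classical_set_scope.
Context {R : realType} {d : nat}.
Implicit Types (X : {fset 'rV[R]_d}) (u x y : 'rV[R]_d).

Lemma dotv_conv u (x y : convex_lmodType 'rV[R]_d) (t : {i01 R}) :
  dotv u (conv t x y) = t%:num * dotv u x + (1 - t%:num) * dotv u y.
Proof. by rewrite /conv /= dotvDr !dotvZr. Qed.

Lemma convex_halfspace u (c : R) :
  @convex_set R 'rV[R]_d [set y | dotv u y <= c].
Proof.
move=> x y t /set_mem /= hx /set_mem /= hy; apply/mem_set => /=.
have t0 : 0 <= t%:num by [].
have t1 : 0 <= 1 - t%:num by rewrite subr_ge0.
rewrite dotv_conv.
by have := ler_wpM2l t0 hx; have := ler_wpM2l t1 hy; lra.
Qed.

(** Keeping a single boundary point preserves convexity; this is what makes the hull touch the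
    hyperplane of a peak only at [x]. *)
Lemma convex_open_halfspace_point u x :
  @convex_set R 'rV[R]_d [set y | dotv u y < dotv u x \/ y = x].
Proof.
apply/convex_setW => y z /set_mem /= hy /set_mem /= hz t t0 t1.
apply/mem_set => /=.
have [->|/eqP yx] := eqVneq y x; last have {}hy : dotv u y < dotv u x by case: hy.
  have [->|/eqP zx] := eqVneq z x; first by right; rewrite convmm.
  have {}hz : dotv u z < dotv u x by case: hz.
  left; rewrite dotv_conv.
  have t1' : 0 < 1 - t%:num by rewrite subr_gt0.
  by have := ltr_pM2l t1' (dotv u z) (dotv u x); rewrite hz; lra.
have {}hz : dotv u z <= dotv u x by case: hz => [/ltW//|->].
left; rewrite dotv_conv.
have t1' : 0 <= 1 - t%:num by rewrite subr_ge0 ltW.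
have := ltr_pM2l t0 (dotv u y) (dotv u x); rewrite hy.
by have := ler_wpM2l t1' hz; lra.
Qed.

Lemma conv_hull_le X u c : (forall z, z \in X -> dotv u z <= c) ->
  conv_hull [set` X] `<=` [set y | dotv u y <= c].
Proof. by move=> h; apply: smallest_sub; [exact: convex_halfspace|move=> z /h]. Qed.

Lemma sub_conv_hull X x : x \in X -> conv_hull [set` X] x.
Proof. by move=> xX A [_]; apply. Qed.

Lemma conv_hull_peak X u x : peak X u x ->
  conv_hull [set` X] `<=` [set y | dotv u y < dotv u x \/ y = x].
Proof.
move=> ux; apply: smallest_sub; first exact: convex_open_halfspace_point.
move=> z /= zX; have [->|zx] := eqVneq z x; first by right.
by left; apply: ux.
Qed.

Lemma peak_le X u x z : peak X u x -> z \in X -> dotv u z <= dotv u x.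
Proof. by move=> ux zX; have [->//|zx] := eqVneq z x; exact/ltW/ux. Qed.

Lemma peak_supporting X u x : u != 0 -> x \in X -> peak X u x ->
  supporting_hyperplane (conv_hull [set` X]) (hyperplane u (dotv u x)).
Proof.
move=> u0 xX ux; exists u, (dotv u x); split=> //.
  by exists x; split => //; exact: sub_conv_hull.
by apply: conv_hull_le => z; exact: peak_le.
Qed.

Lemma peak_hyperplane X u x : x \in X -> peak X u x ->
  [set` X] `&` hyperplane u (dotv u x) = [set x].
Proof.
move=> xX ux; apply/seteqP; split=> [z [/= zX zx]|z /= ->]; last by split.
by apply/eqP; apply: contraT => /(ux z zX); rewrite zx ltxx.
Qed.

Lemma hyperplaneN u c : hyperplane (- u) (- c) = hyperplane u c.
Proof.
by apply/seteqP; split=> y; rewrite /hyperplane /= dotvNl => /eqP;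
  rewrite ?eqr_opp => /eqP // ->.
Qed.

(** The two hyperplanes are level sets of the same [u]; the lower one supports through [- u]. *)
Lemma antipodal_strictly X x y : antipodal X x y -> strictly_antipodal X x y.
Proof.
move=> [xX yX xy [u [ux uy]]]; split=> //.
have uyx : dotv u y < dotv u x by apply: ux; rewrite // eq_sym.
have u0 : u != 0 by apply: contraTneq uyx => ->; rewrite !dot0v ltxx.
have hy : hyperplane (- u) (dotv (- u) y) = hyperplane u (dotv u y).
  by rewrite dotvNl hyperplaneN.
exists (hyperplane u (dotv u x)), (hyperplane u (dotv u y)); split.
- exact: peak_supporting.
- by rewrite -hy; apply: peak_supporting => //; rewrite oppr_eq0.
- split; first by exists u, (dotv u x), (dotv u y).
  move=> /seteqP[/(_ x erefl)]; rewrite /hyperplane /= => xy'.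
  by rewrite xy' ltxx in uyx.
- exact: peak_hyperplane.
- by rewrite -hy; apply: peak_hyperplane.
Qed.

Lemma strictly_convex_exposed X x : strictly_convex_position X -> x \in X ->
  exposed X x.
Proof.
move=> Xsc xX; have : [set` X] x by []; rewrite Xsc => -[H [u [c [u0 HE _ hc]]]].
rewrite HE => Hx; have [_ xH] : (conv_hull [set` X] `&` hyperplane u c) x.
  by rewrite Hx.
exists u => z zX zx; have zC := sub_conv_hull zX.
rewrite xH lt_neqAle hc // andbT; apply: contraNneq zx => zc.
have : (conv_hull [set` X] `&` hyperplane u c) z by split.
by rewrite Hx /= => ->.
Qed.

(** This serves to place an explicit set in the family. Having two points makes each exposing
    functional nonzero. *)
Lemma exposed_strictly_convex X : (1 < #|` X|%fset)%N ->
  (forall x, x \in X -> exposed X x) -> strictly_convex_position X.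
Proof.
move=> X2 Xexp; apply/seteqP; split=> [x /= xX|v].
  have [u ux] := Xexp x xX.
  have u0 : u != 0.
    have [y yX yx] : exists2 y, y \in X & y != x.
      apply: contrapT => no; move: X2; rewrite ltnNge => /negP; apply.
      apply: leq_trans (_ : #|` [fset x]%fset| <= 1)%N; last by rewrite cardfs1.
      apply/fsubset_leq_card/fsubsetP => y yX.
      by rewrite inE; apply: contraT => yx; case: no; exists y.
    by apply: contraTneq (ux y yX yx) => ->; rewrite !dot0v ltxx.
  exists (hyperplane u (dotv u x)); first exact: peak_supporting.
  apply/seteqP; split=> [z [/(conv_hull_peak ux) /= [zx|//]]|z /= ->].
    by rewrite /hyperplane /= => zx'; rewrite zx' ltxx in zx.
  by split=> //; exact: sub_conv_hull.
move=> [H [u [c [u0 HE _ hc]]]]; rewrite HE => Hv /=; apply: contrapT => vX.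
have [vC vc] : (conv_hull [set` X] `&` hyperplane u c) v by rewrite Hv.
(* A vertex outside [X] would leave all of [X], and so the hull, strictly below [c]. *)
have lt z : z \in X -> dotv u z < c.
  move=> zX; have zC := sub_conv_hull zX; rewrite lt_neqAle hc // andbT.
  apply/eqP => zc; apply: vX.
  have : (conv_hull [set` X] `&` hyperplane u c) z by split.
  by rewrite Hv /= => <-.
have [z0 z0X] : exists z, z \in X.
  by apply/fset0Pn; rewrite -cardfs_gt0; apply: ltnW.
have [z zX zmax] := seq_argmax (dotv u) z0X.
have := conv_hull_le zmax vC; rewrite /= vc leNgt lt //.
Qed.

Lemma aff_hull_spanning X : aff_hull [set` X] = setT -> spanning X.
Proof.
move=> XT u uconst.
have [X0|[x xX]] := fset_0Vmem X.
  apply/eqP; apply: contraT => u0.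
  (* For empty [X] the hull is empty, as the empty set is affine. *)
  have : aff_hull [set` X] u by rewrite XT.
  move=> /(_ set0); case; split; first by move=> ? ? ? [].
  by move=> z /=; rewrite X0.
have h y : dotv u y = dotv u x.
  have : aff_hull [set` X] y by rewrite XT.
  apply: (@smallest_sub _ affine_set _ [set y | dotv u y = dotv u x]).
    by move=> a b t /= ax bx; rewrite dotvDr !dotvZr ax bx; ring.
  by move=> z /= zX; apply: uconst.
apply/eqP; apply: contraT => /dotvv_gt0.
by rewrite h -(h 0) dotv0 ltxx.
Qed.

(** An ordered pair is recovered from its underlying set and the truth value telling whether its
    first entry is the representative [h] of that set. *)
Lemma npairs_le_sa X : (npairs X <= 2 * sa X)%N.
Proof.
rewrite /sa; set E := [fset e in _ | _]%fset.
rewrite /npairs (sum_pairs _ _ (fun x y => `[< antipodal X x y >])).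
pose h (e : {fset 'rV[R]_d}) : 'rV[R]_d := head 0 (enum_fset e).
pose f (q : 'rV[R]_d * 'rV[R]_d) :=
  ([fset q.1; q.2]%fset, q.1 == h [fset q.1; q.2]%fset).
have hP (x y : 'rV[R]_d) : h [fset x; y]%fset = x \/ h [fset x; y]%fset = y.
  have : h [fset x; y]%fset \in [fset x; y]%fset.
    have xF : x \in enum_fset [fset x; y]%fset := fset21 x y.
    apply: (_ : _ \in enum_fset _); rewrite /h.
    by case: (enum_fset _) xF => // a s _; exact: mem_head.
  by rewrite !inE => /orP[]/eqP->; auto.
set s := [seq q <- _ | _].
have sz : size [seq (e, b) | e <- enum_fset E, b <- [:: true; false]] =
    (2 * #|` E|%fset)%N.
  by rewrite size_allpairs mulnC.
rewrite -sz -(size_map f); apply: uniq_leq_size.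
  rewrite map_inj_in_uniq; last first.
    move=> [x y] [x' y']; rewrite !mem_filter /= => /andP[/asboolP[_ _ xy _] _].
    move=> /andP[/asboolP[_ _ xy' _] _] [e]; rewrite e => eb.
    have xE : x \in [fset x'; y']%fset by rewrite -e fset21.
    have yE : y \in [fset x'; y']%fset by rewrite -e fset22.
    move: xE yE; rewrite !inE => /orP[/eqP xE|/eqP xE] /orP[/eqP yE|/eqP yE].
    - by rewrite xE yE eqxx in xy.
    - by rewrite xE yE.
    - move: eb; rewrite xE; case: (hP x' y') => ->; rewrite eqxx.
        by rewrite eq_sym (negPf xy').
      by rewrite (negPf xy').
    - by rewrite xE yE eqxx in xy.
  by apply/filter_uniq/allpairs_uniq; rewrite ?fset_uniq // => -[? ?] [? ?].
move=> q /mapP[[x y]]; rewrite mem_filter => /andP[/asboolP xy _] ->.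
apply: (allpairs_f (fun e b => (e, b))).
  have [xX yX _ _] := xy.
  rewrite -[_ \in _]/([fset x; y]%fset \in E) !inE /=; apply/andP; split.
    by rewrite fpowersetE; apply/fsubsetP => z; rewrite !inE => /orP[]/eqP->.
  by apply/asboolP; exists x, y; split => //; exact: antipodal_strictly.
by case: (x == _).
Qed.

End Polytope.

(** * A truncated cross-polytope in the family *)

Section Truncated_cross_polytope.
Local Open Scope classical_set_scope.
Context {R : realType} (d k : nat) (kd : (k < d)%N) (k0 : (0 < k)%N).

Local Notation e := (@delta_mx R 1 d 0).

(** A witness that the family is nonempty, required because [min_nat] is 0 on the empty set. *)
Definition cross_seq : seq 'rV[R]_d :=
  [seq e a | a <- enum 'I_d] ++
  [seq - e (widen_ord (ltnW kd) a) | a <- enum 'I_k].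

Definition cross : {fset 'rV[R]_d} := [fset x in cross_seq]%fset.

Lemma dotv_delta a x : dotv (e a) x = x 0 a.
Proof.
rewrite /dotv mxE (bigD1 a) //= big1 ?addr0 => [|b ba]; rewrite !mxE !eqxx ?mul1r //.
by rewrite (negPf ba) mul0r.
Qed.

Lemma delta_inj : injective e.
Proof.
move=> a b /rowP/(_ a); rewrite !mxE !eqxx /=; have [//|_] := eqVneq a b.
by move=> /eqP; rewrite oner_eq0.
Qed.

Lemma delta_neq_opp a b : e a != - e b.
Proof.
apply/eqP => /rowP/(_ a)/eqP; rewrite !mxE !eqxx /= gt_eqF //.
by case: (_ == _); rewrite /= ?oppr0 ?ltrN10 ?ltr01 // (lt_trans (ltrN10 _)).
Qed.

Lemma cross_seq_uniq : uniq cross_seq.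
Proof.
rewrite cat_uniq; apply/and3P; split.
- by rewrite map_inj_uniq ?enum_uniq //; exact: delta_inj.
- apply/hasPn => x /mapP[a _ ->]; apply/mapP => -[b _ ab].
  by have := delta_neq_opp b (widen_ord (ltnW kd) a); rewrite ab eqxx.
rewrite map_inj_uniq ?enum_uniq // => a b /oppr_inj/delta_inj/(congr1 val) /= ab.
exact: val_inj.
Qed.

Lemma card_cross : #|` cross|%fset = (d + k)%N.
Proof.
rewrite card_fseq undup_id ?cross_seq_uniq // size_cat !size_map.
by rewrite -!enumT !size_enum_ord.
Qed.

Lemma mem_crossP x : reflect
  ((exists a, x = e a) \/ (exists2 a : 'I_d, (a < k)%N & x = - e a)) (x \in cross).
Proof.
rewrite /cross in_fset mem_cat; apply: (iffP orP) => -[].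
- by move=> /mapP[a _ ->]; left; exists a.
- by move=> /mapP[a _ ->]; right; exists (widen_ord (ltnW kd) a) => /=.
- by move=> [a ->]; left; rewrite map_f // mem_enum.
move=> [a ak ->]; right; apply/mapP; exists (Ordinal ak); rewrite ?mem_enum //.
Qed.

(** Each point exposes itself: as a functional it is 1 there and 0 or -1 at the other points. *)
Lemma cross_exposed x : x \in cross -> exposed cross x.
Proof.
have opp_lt1 (c : bool) : - c%:R < 1 :> R.
  by case: c; rewrite /= ?oppr0 ?ltr01 // (lt_trans (ltrN10 _)).
move=> /mem_crossP[[a ->]|[a ak ->]].
  exists (e a) => z /mem_crossP[[b ->]|[b bk ->]] zx; rewrite !dotv_delta !mxE !eqxx //=.
  have /negPf-> : a != b by apply: contraNneq zx => ->.
  exact: ltr01.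
exists (- e a) => z /mem_crossP[[b ->]|[b bk ->]] zx;
  rewrite !dotvNl !dotv_delta !mxE !eqxx /= ?opprK //.
have /negPf-> : a != b by apply: contraNneq zx => ->.
exact: ltr01.
Qed.

(** The midpoint of [e a] and [- e a] is 0, and an affine set containing 0 is closed under scaling
    and addition. *)
Lemma cross_aff_hull : aff_hull [set` cross] = setT.
Proof.
apply/seteqP; split=> // x _ C [/= Caff XC].
have Ce a : C (e a) by apply: XC => /=; apply/mem_crossP; left; exists a.
have C0 : C 0.
  pose a := Ordinal (ltn_trans k0 kd).
  have Cn : C (- e a) by apply: XC => /=; apply/mem_crossP; right; exists a.
  have := Caff _ _ (1 / 2) (Ce a) Cn.
  have h : 1 / 2 - (1 - 1 / 2) = 0 :> R by lra.
  by rewrite scalerN -scalerBl h scale0r.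
have CZ t y : C y -> C (t *: y).
  by move=> Cy; have := Caff _ _ t Cy C0; rewrite scaler0 addr0.
have CD y z : C y -> C z -> C (y + z).
  move=> Cy Cz; have := CZ 2 _ (Caff _ _ (1 / 2) Cy Cz).
  have h1 : 2 * (1 / 2) = 1 :> R by lra.
  have h2 : 2 * (1 - 1 / 2) = 1 :> R by lra.
  by rewrite scalerDr !scalerA h1 h2 !scale1r.
rewrite [x]row_sum_delta; apply: big_ind => // a _; exact: CZ.
Qed.

Lemma cross_in_family : strictly_convex_family R d (d + k) cross.
Proof.
split; [exact: card_cross|exact: cross_aff_hull|].
apply: exposed_strictly_convex cross_exposed.
by rewrite card_cross; lia.
Qed.

End Truncated_cross_polytope.

(** * The minimum over the family and the final estimates *)

Lemma min_nat_mem (S : classical_sets.set nat) n : S n -> S (min_nat S).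
Proof.
move=> Sn; have ex : exists n, `[< S n >] by exists n; apply/asboolP.
suff : exists m, (S `&` lbound S)%classic m by move=> /(xgetPex 0%N) [].
exists (ex_minn ex); case: ex_minnP => m /asboolP Sm mmin; split=> // j Sj.
by apply: mmin; apply/asboolP.
Qed.

Lemma sa_lower_bound (R : realType) d k (X : {fset 'rV[R]_d}) :
  strictly_convex_family R d (d + k) X -> ('C(d.+1, 2) <= sa X + 'C(k, 2))%N.
Proof.
move=> [Xn Xaff Xsc].
have := npairs_bound (fset_uniq X) (fun x => @strictly_convex_exposed R d X x Xsc)
  (aff_hull_spanning Xaff).
by have := npairs_le_sa X; rewrite Xn addKn; lia.
Qed.

Theorem theorem2p18 (R : realType) :
  (forall d k : nat, (2 <= d)%N -> (1 <= k <= d - 1)%N ->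
     (d%:R ^+ 2 - k%:R ^+ 2 + d%:R + k%:R) / 2
       <= (sa_min R d (d + k))%:R :> R)
  /\
  (exists c1 c2 : R, [/\ 0 < c1, 0 < c2 &
     forall d k : nat, (2 <= d)%N -> (1 <= k <= d - 1)%N ->
       c1 * ((d%:R - k%:R) * d%:R)
         <= (d%:R ^+ 2 - k%:R ^+ 2 + d%:R + k%:R) / 2
         <= c2 * ((d%:R - k%:R) * d%:R)]).
Proof.
split=> [d k d2 /andP[k1 kd]|].
  have {}kd : (k < d)%N by lia.
  (* Since the family is nonempty, the minimum is attained at some [X]. *)
  have [X XF <-] : [set sa X | X in strictly_convex_family R d (d + k)]%classic
      (sa_min R d (d + k)).
    apply: (min_nat_mem (n := sa (@cross R d k kd))).
    by exists (@cross R d k kd) => //; exact: cross_in_family.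
  have := sa_lower_bound XF.
  have h n : (2 * 'C(n.+1, 2) = n * n + n)%N.
    by elim: n => // n IHn; rewrite (binS n.+1 1) bin1; lia.
  have hk : (2 * 'C(k, 2) + k = k * k)%N.
    by case: k k1 {kd XF} => // k' _; rewrite h; lia.
  move=> b; have {}b : (d * d + d + k <= 2 * sa X + k * k)%N by have := h d; lia.
  have : (d * d + d + k)%:R <= (2 * sa X + k * k)%:R :> R by rewrite ler_nat.
  by rewrite !natrD !natrM !expr2; lra.
(* The expression is [(d + k) * (d - k + 1) / 2], where [d <= d + k <= 2 * d] and
   [d - k <= d - k + 1 <= 2 * (d - k)]. *)
exists (1 / 2), 2; split; [lra|lra|] => d k d2 /andP[k1 kd].
(* With [d = k + m + 1] the square of [k] cancels, and both bounds become linear in [k], [m],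
   [k * m] and [m * m]. *)
have [m dE] : exists m, d = (k + m.+1)%N by exists (d - k.+1)%N; lia.
rewrite dE natrD -(natr1 m).
have : 1 <= k%:R :> R by rewrite ler1n.
have : 0 <= m%:R :> R by rewrite ler0n.
move: (k%:R : R) (m%:R : R) => K M M0 K1; rewrite !expr2.
have KM : 0 <= K * M by rewrite mulr_ge0 //; lra.
have MM : 0 <= M * M by rewrite mulr_ge0.
by apply/andP; split; lra.
Qed.
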